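(* If $G$ is in $1$-$HNG$, then $\omega(G)$ and $\alpha(G)$ can be determined in polynomial time; that is, there are algorithms that, given a graph $G$ in $1$-$HNG$, compute $\omega(G)$ and $\alpha(G)$ in time polynomial in $|V(G)|$.
   Context: All graphs are finite, simple, and have at least one vertex; induced subgraphs are taken on nonempty vertex sets. $\omega$ is the clique number, $\alpha$ the independence number, $\chi$ the chromatic number, and $\theta(G)=\chi(\overline{G})$ the clique cover number. A graph $G$ is in the class $1$-$HNG$ if every induced subgraph $H$ of $G$ (including $G$ itself) satisfies $\chi(H)+\theta(H)\ge |V(H)|$. *)

(* Defs.v *)
From mathcomp Require Import all_boot.

Set Implicit Arguments.
Unset Strict Implicit.
Unset Printing Implicit Defensive.

Record sgraph (T : finType) := SGraph {
  edge :> rel T;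
  edge_sym : symmetric edge;
  edge_irr : irreflexive edge }.

Section Graphs.
Variable T : finType.
Implicit Types (G : sgraph T) (S : {set T}).

Definition co_edge G : rel T := fun x y => (x != y) && ~~ G x y.

Lemma co_edge_sym G : symmetric (co_edge G).
Proof. by move=> x y; rewrite /co_edge eq_sym edge_sym. Qed.

Lemma co_edge_irr G : irreflexive (co_edge G).
Proof. by move=> x; rewrite /co_edge eqxx. Qed.

Definition complement G : sgraph T := SGraph (@co_edge_sym G) (@co_edge_irr G).

Definition ind_edge G S : rel {x : T | x \in S} := fun x y => G (val x) (val y).

Lemma ind_edge_sym G S : symmetric (@ind_edge G S).
Proof. by move=> x y; rewrite /ind_edge edge_sym. Qed.

Lemma ind_edge_irr G S : irreflexive (@ind_edge G S).
Proof. by move=> x; rewrite /ind_edge edge_irr. Qed.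

Definition induced G S : sgraph {x : T | x \in S} :=
  SGraph (@ind_edge_sym G S) (@ind_edge_irr G S).

Definition clique G S := [forall x in S, forall y in S, (x != y) ==> G x y].

Definition independent G S := [forall x in S, forall y in S, ~~ G x y].

Definition omega G : nat := \max_(S : {set T} | clique G S) #|S|.

Definition alpha G : nat := \max_(S : {set T} | independent G S) #|S|.

Definition colorable G (k : nat) :=
  [exists f : {ffun T -> 'I_k}, forall x, forall y, G x y ==> (f x != f y)].

Lemma colorable_card G : exists k, colorable G k.
Proof.
exists #|T|; apply/existsP; exists [ffun x => enum_rank x].
apply/forallP=> x; apply/forallP=> y; apply/implyP=> Gxy; rewrite !ffunE.
by apply: contraTneq Gxy => /enum_rank_inj ->; rewrite edge_irr.
Qed.

Definition chi G : nat := ex_minn (colorable_card G).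

End Graphs.

Definition theta (T : finType) (G : sgraph T) : nat := chi (complement G).

Definition one_HNG (T : finType) (G : sgraph T) : Prop :=
  forall S : {set T}, S != set0 ->
    #|{: {x : T | x \in S}}| <= chi (induced G S) + theta (induced G S).

(* Random access machines in the style of Cook and Reckhow, over registers
   X_0, X_1, ... holding natural numbers, with unit cost per instruction.
   There is deliberately no multiplication: with addition and truncated
   subtraction only, register contents gain at most one bit per step, so that
   unit-cost polynomial time is polynomial time on Turing machines. *)
Inductive instr :=
  | Const of nat & nat        (* Const i c : X_i := c *)
  | Add of nat & nat & nat    (* Add i j k : X_i := X_j + X_k *)
  | Sub of nat & nat & nat    (* Sub i j k : X_i := X_j - X_k, truncated at 0 *)
  | Get of nat & nat          (* Get i j : X_i := X_(X_j) *)
  | Put of nat & nat          (* Put i j : X_(X_i) := X_j *)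
  | Jump of nat & nat.        (* Jump j m : go to instruction m if X_j > 0 *)

Definition program := seq instr.

Definition registers := nat -> nat.

Definition set_reg (X : registers) (i v : nat) : registers :=
  fun r => if r == i then v else X r.

(* Program counter and registers. *)
Definition config := (nat * registers)%type.

Definition exec (a : instr) (m : config) : config :=
  let: (pc, X) := m in
  match a with
  | Const i c => (pc.+1, set_reg X i c)
  | Add i j k => (pc.+1, set_reg X i (X j + X k))
  | Sub i j k => (pc.+1, set_reg X i (X j - X k))
  | Get i j => (pc.+1, set_reg X i (X (X j)))
  | Put i j => (pc.+1, set_reg X (X i) (X j))
  | Jump j l => (if 0 < X j then l else pc.+1, X)
  end.

(* The machine halts when the program counter leaves the program. *)
Definition halted (P : program) (m : config) : bool := size P <= m.1.

Definition step (P : program) (m : config) : config :=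
  if onth P m.1 is Some a then exec a m else m.

(* Initial registers: X_0 = n, the row-major adjacency matrix (entries 0 or 1)
   in X_1, ..., X_(n * n), and 0 elsewhere. *)
Definition input (n : nat) (G : sgraph 'I_n) : registers := fun r =>
  if r == 0 then n
  else [exists i : 'I_n, exists j : 'I_n, (r == (i * n + j).+1) && G i j].

(* A single program handles all graphs of the class C with at least one
   vertex; nothing is required of it on other inputs. The result is read in
   X_0. *)
Definition poly_time_computable_on (C : forall n, sgraph 'I_n -> Prop)
    (f : forall n, sgraph 'I_n -> nat) : Prop :=
  exists (P : program) (c k : nat), forall (n : nat) (G : sgraph 'I_n),
    0 < n -> C n G ->
    exists2 t, t <= c * n ^ k + c &
      let m := iter t (step P) (0, input G) in halted P m /\ m.2 0 = f n G.

(* Main.v *)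
(** 3K2 has chromatic number 2 and clique cover number 3, so a graph in 1-HNG
    contains no induced 3K2; nor does its complement, as the class is closed
    under complementation. A graph without induced 3K2 has only polynomially
    many maximal independent sets (Farber; Balas and Yu): order the vertices
    and let v be the last vertex such that S is not maximal among the vertices
    before v, with w < v a witness. Then S avoids N(v) and N(w) before v, and
    is completed greedily from v on. Before v, S lives in a graph without
    induced 2K2, where the same argument yields v' and w', and S contains all
    vertices before v' outside N(v') and N(w'). Hence alpha is the maximum,
    over all (v, w, v', w'), of the size of the set found by one greedy pass
    that skips the vertices x < v adjacent to v or w and the vertices x < v'
    adjacent to v' or w'. For omega, run the same program on complemented
    adjacency bits. *)

From Pilot Require Import Defs.
From mathcomp Require Import all_boot zify.
(* Imported again because eqtype shadows the instruction [Sub]. *)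
Import Pilot.Defs.

Set Implicit Arguments.
Unset Strict Implicit.
Unset Printing Implicit Defensive.

(** * Graphs without induced 3K2 *)

Section Invariants.
Variable T : finType.
Implicit Types (G : sgraph T) (S : {set T}).

Lemma chi_le G k (f : T -> nat) : (forall x, f x < k) ->
  (forall x y, G x y -> f x != f y) -> chi G <= k.
Proof.
move=> fk fP; rewrite /chi; case: ex_minnP => m _; apply.
apply/existsP; exists [ffun x => Ordinal (fk x)].
apply/forallP=> x; apply/forallP=> y.
by rewrite !ffunE -val_eqE /=; apply/implyP/fP.
Qed.

Lemma eq_chi G1 G2 : G1 =2 G2 -> chi G1 = chi G2.
Proof.
move=> eqG; apply: eq_ex_minn => k; apply: eq_existsb => f.
by apply: eq_forallb => x; apply: eq_forallb => y; rewrite eqG.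
Qed.

Lemma complementK G : complement (complement G) =2 G.
Proof.
move=> x y; rewrite /= /co_edge negb_and !negbK.
by case: eqP => // ->; rewrite edge_irr.
Qed.

End Invariants.

Section Hereditary.
Variable T : finType.
Implicit Types (G : sgraph T) (S : {set T}).

Lemma induced_complement G S :
  induced (complement G) S =2 complement (induced G S).
Proof. by []. Qed.

(** Complementation commutes with taking induced subgraphs and swaps [chi] and [theta]. *)
Lemma one_HNG_complement G : one_HNG G -> one_HNG (complement G).
Proof.
move=> hG S /hG; rewrite addnC /theta (eq_chi (@induced_complement G S)).
rewrite [X in _ -> _ <= _ + X](_ : _ = chi (induced G S)) //.
by apply: eq_chi => x y; rewrite -[RHS]complementK.
Qed.

Lemma omega_complement G : omega G = alpha (complement G).
Proof.
apply: eq_bigl => S; apply: eq_forallb => x; apply: implyb_id2l => _.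
apply: eq_forallb => y; apply: implyb_id2l => _.
by rewrite /= /co_edge negb_and implybE !negbK.
Qed.

(** Distinctness of the six vertices need not be assumed: a vertex shared by two edges is adjacent
    to the other end of either, so the adjacency asked for is present. *)
Definition free_3K2 G := forall a b c d e f,
  G a b -> G c d -> G e f ->
  has (fun x => has (G x) [:: a; b]) [:: c; d; e; f]
  || has (fun x => has (G x) [:: c; d]) [:: e; f].

Lemma one_HNG_free_3K2 G : one_HNG G -> free_3K2 G.
Proof.
move=> hG a b c d e f Gab Gcd Gef; apply/negPn/negP => /=.
rewrite !orbF !negb_or => /andP[/and4P[ca da ea fa] /andP[ec fc]].
case/andP: ca da ea fa ec fc => [/negbTE ca /negbTE cb].
move=> /andP[/negbTE da /negbTE db] /andP[/negbTE ea /negbTE eb].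
move=> /andP[/negbTE fa /negbTE fb] /andP[/negbTE ec /negbTE ed].
move=> /andP[/negbTE fc /negbTE fd].
have neq x y : G x y -> x != y by apply: contraTneq => ->; rewrite edge_irr.
have neq2 z x y : G x z -> G y z = false -> x != y.
  by move=> xz; apply: contraFneq => <-.
have sG := edge_sym G.
have Gba := Gab; have Gdc := Gcd; have Gfe := Gef.
rewrite sG in Gba; rewrite sG in Gdc; rewrite sG in Gfe.
pose s := [:: a; b; c; d; e; f].
(* Vertices on different edges are distinct because a third vertex is adjacent to one and not to the
   other. *)
have us : uniq s.
  rewrite /= !inE !negb_or (neq _ _ Gab) (neq _ _ Gcd) (neq _ _ Gef).
  rewrite !(neq2 b a) // !(neq2 a b) // !(neq2 d c) // !(neq2 c d) //.
pose S := [set x in s].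
have S0 : S != set0 by apply/set0Pn; exists a; rewrite inE mem_head.
have := hG S S0.
have -> : #|{: {x : T | x \in S}}| = 6.
  by rewrite card_sig (eq_card (B := S)) // cardsE (card_uniqP us).
suff [h2 h3] : chi (induced G S) <= 2 /\ theta (induced G S) <= 3.
  by move=> h6; have := leq_trans h6 (leq_add h2 h3).
have nthS (z : {x | x \in S}) :
    exists2 i, i < 6 & val z = nth a s i /\ index (val z) s = i.
  have := valP z; rewrite inE => /(nthP a)[i lti <-].
  by exists i => //; rewrite index_uniq.
split.
  (* Parity of the position in [s] separates the two ends of each edge. *)
  apply: (chi_le (f := fun z => odd (index (val z) s))) => [x|x y].
    by rewrite ltnS leq_b1.
  have nadj := (ca, cb, da, db, ea, eb, fa, fb, ec, ed, fc, fd).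
  have [i lti [exi ->]] := nthS x; have [j ltj [eyj ->]] := nthS y.
  rewrite -[edge _ x y]/(G (val x) (val y)) exi eyj {exi eyj}.
  case: i lti j ltj => [|[|[|[|[|[|]]]]]] //= _ [|[|[|[|[|[|]]]]]] //= _;
  by rewrite ?(edge_irr, nadj) // sG nadj.
(* Halving the position gives the three edges as colour classes, which are cliques. *)
apply: (chi_le (f := fun z => (index (val z) s)./2)) => [x|x y].
  by have [i lti [_ ->]] := nthS x; rewrite ltn_half_double.
have [i lti [exi ->]] := nthS x; have [j ltj [eyj ->]] := nthS y.
rewrite -[edge _ x y]/((val x != val y) && ~~ G (val x) (val y)) exi eyj {exi eyj}.
case: i lti j ltj => [|[|[|[|[|[|]]]]]] //= _ [|[|[|[|[|[|]]]]]] //= _;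
by rewrite ?eqxx ?Gab ?Gba ?Gcd ?Gdc ?Gef ?Gfe ?andbF.
Qed.

End Hereditary.

(** * Greedy independent sets *)

Section Greedy.
Variables (e : rel nat) (blk : pred nat).

Fixpoint greedy k : seq nat :=
  if k is x.+1 then
    let s := greedy x in if blk x || has (e x) s then s else x :: s
  else [::].

Lemma greedy_lt k x : x \in greedy k -> x < k.
Proof.
elim: k => //= k IH; case: ifP => _; first by move/IH/ltnW.
by rewrite inE ltnS leq_eqVlt => /predU1P[->|/IH ->]; rewrite ?eqxx ?orbT.
Qed.

Lemma mem_greedyS k x :
  x \in greedy k.+1 =
  if x == k then ~~ (blk k || has (e k) (greedy k)) else x \in greedy k.
Proof.
rewrite /=; case: ifP => _; rewrite ?inE; case: eqP => // ->.
by apply/negP => /greedy_lt; rewrite ltnn.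
Qed.

Lemma mem_greedy k x : x < k ->
  x \in greedy k = ~~ (blk x || has (e x) (greedy x)).
Proof.
elim: k => // k IH; rewrite ltnS leq_eqVlt mem_greedyS.
by case: eqP => [-> | _ /IH].
Qed.

Lemma greedy_uniq k : uniq (greedy k).
Proof.
elim: k => //= k IH; case: ifP => //= _; rewrite IH andbT.
by apply/negP => /greedy_lt; rewrite ltnn.
Qed.

Lemma sub_greedy j k x : x < j -> j <= k -> x \in greedy k = (x \in greedy j).
Proof. by move=> xj jk; rewrite !mem_greedy // (leq_trans xj). Qed.

Lemma greedy_indep k x y :
  x \in greedy k -> y \in greedy k -> y < x -> ~~ e x y.
Proof.
move=> xk yk yx; have xltk := greedy_lt xk.
move: xk; rewrite mem_greedy // negb_or => /andP[_ /hasPn]; apply.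
by rewrite -(sub_greedy yx (ltnW xltk)).
Qed.

(** The hypothesis determines membership in [S] recursively from smaller vertices, and [greedy]
    obeys the same recursion. *)
Lemma greedy_ord n (S : {set 'I_n}) :
  (forall x : 'I_n, (x \in S) =
     ~~ (blk x || [exists y : 'I_n, [&& y \in S, y < x & e x y]])) ->
  #|S| = size (greedy n).
Proof.
move=> SP; have memS (x : 'I_n) : (x \in S) = (val x \in greedy n).
  have [k] := ubnP (val x); elim: k x => // k IH x; rewrite ltnS => xk.
  rewrite SP (mem_greedy (ltn_ord x)); congr (~~ (_ || _)).
  apply/existsP/hasP => [[y /and3P[yS yx exy]]|[y yx exy]].
    exists (val y) => //.
    by rewrite -(sub_greedy yx (ltnW (ltn_ord x))) -IH // (leq_trans yx).
  have ltyx := greedy_lt yx; exists (Ordinal (ltn_trans ltyx (ltn_ord x))).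
  rewrite /= ltyx exy IH ?(leq_trans ltyx) //=.
  by rewrite (sub_greedy ltyx (ltnW (ltn_ord x))) yx.
rewrite cardE -(size_map val); apply/perm_size/uniq_perm.
- by rewrite map_inj_uniq ?enum_uniq //; apply: val_inj.
- exact: greedy_uniq.
move=> x; apply/mapP/idP => [[y + ->]|xg]; first by rewrite mem_enum memS.
by exists (Ordinal (greedy_lt xg)); rewrite // mem_enum memS.
Qed.

End Greedy.

(* A pair [(v, w)] with [v = 0] blocks nothing. *)
Definition blocked (e : rel nat) (v w x : nat) := (x < v) && (e x v || e x w).

(** * Maximal independent sets, their gaps and greedy completion *)

Section Independent.
Variables (n : nat) (G : sgraph 'I_n).
Implicit Types (A S : {set 'I_n}) (x y v w : 'I_n).

Lemma independentP S :
  reflect {in S &, forall x y, ~~ G x y} (independent G S).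
Proof.
apply: (iffP forall_inP) => h x => [y xS|xS].
  by move/forall_inP: (h x xS); apply.
by apply/forall_inP => y; apply: h.
Qed.

Lemma card_le_alpha S : independent G S -> #|S| <= alpha G.
Proof. by move=> iS; rewrite /alpha (bigD1 S) //= leq_maxl. Qed.

Lemma alpha_maximal : exists S, [/\ independent G S, #|S| = alpha G &
  forall x, x \notin S -> exists2 y, y \in S & G x y].
Proof.
have i0 : independent G set0 by apply/independentP => x y; rewrite inE.
have c0 : 0 < #|independent G| by apply/card_gt0P; exists set0.
have [S iS eS] := eq_bigmax_cond (fun S : {set 'I_n} => #|S|) c0.
exists S; split=> // x xS.
apply/exists_inP; apply: contraT => /exists_inPn hx.
have iU : independent G (x |: S).
  apply/independentP => y z; rewrite !inE.
  case/predU1P => [->|yS]; case/predU1P => [->|zS]; rewrite ?edge_irr ?hx //.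
    by rewrite edge_sym hx.
  exact: (independentP _ iS).
have := card_le_alpha iU.
by rewrite cardsU1 xS /alpha eS add1n ltnn.
Qed.

(* Farber's argument: [v] is the last vertex such that [S] restricted to the
   vertices before [v] is not maximal, and [w] witnesses this. *)
Lemma last_gap A S : independent G S ->
  (forall x, x \in A -> x \notin S -> exists2 y, y \in S & G x y) ->
  (forall x, x \in A -> x \notin S -> exists y, [/\ y \in S, G x y & y < x])
  \/ exists v w, [/\ v \in S, w \in A, G v w,
       forall y, y \in S -> y < v -> ~~ G w y &
       forall x, x \in A -> x \notin S ->
         exists y, [/\ y \in S, G x y & y <= maxn x v]].
Proof.
move=> iS maxS.
(* [gap v w] makes [v] the first neighbour of [w] in [S], on whichever side of [w] it lies. *)
pose gap v w := [&& v \in S, w \in A, G v w &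
  [forall y in S, (y < v) ==> ~~ G w y]].
pose low x := [exists y, [&& y \in S, G x y & y < x]].
have lowP x : low x -> exists y, [/\ y \in S, G x y & y < x].
  by case/existsP => y /and3P[]; exists y.
have gapx x : x \in A -> x \notin S -> ~~ low x -> exists v, gap v x.
  move=> xA xS _; have [y0 y0S xy0] := maxS x xA xS.
  pose P y := (y \in S) && G x y.
  have Py0 : P y0 by rewrite /P y0S.
  case: (arg_minnP (@nat_of_ord n) Py0) => v /andP[vS xv] vmin.
  exists v; rewrite /gap vS xA edge_sym xv; apply/forall_inP => y yS.
  apply/implyP => yv; apply/negP => xy.
  by have := vmin y; rewrite /P yS xy leqNgt yv => /(_ isT).
case: (pickP (fun v => [exists w, gap v w])) => [v0 gap0|nogap].
  (* With [v] the largest first neighbour, any vertex of [A] outside [S] without an earlier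
     neighbour in [S] has its first one at or before [v]. *)
  case: (@arg_maxnP _ v0 (fun v => [exists w, gap v w]) (@nat_of_ord n) gap0) => v /existsP[w].
  case/and4P => vS wA vw /forall_inP wv vmax; right; exists v, w; split=> //.
    by move=> y yS; apply/implyP/wv.
  move=> x xA xS; case: (boolP (low x)) => [/lowP[y [yS xy yx]]|lx].
    by exists y; rewrite leq_max (ltnW yx).
  have [y gy] := gapx x xA xS lx; exists y.
  have yv : y <= v by apply: vmax; apply/existsP; exists x.
  by case/and4P: gy => -> _ + _; rewrite edge_sym => ->; rewrite leq_max yv orbT.
left => x xA xS; apply: lowP; apply: contraT => /(gapx x xA xS)[v gv].
by have /existsP[] := nogap v; exists x.
Qed.

(** [None] stands for the absence of a gap, when every vertex concerned outside the set has an
    earlier neighbour in it. *)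
Definition nonblocked x (p : option ('I_n * 'I_n)) :=
  if p is Some (v, w) then (x < v) ==> ~~ G x v && ~~ G x w else true.

Definition is_arc (p : option ('I_n * 'I_n)) :=
  if p is Some (v, w) then G v w else true.

(** Two applications of [last_gap] suffice: an unblocked vertex before the second gap that is not in
    [S] would form, with a neighbour in [S], a third edge not joined to the two gap edges. *)
Lemma maximal_two_gaps S : free_3K2 G -> independent G S ->
  (forall x, x \notin S -> exists2 y, y \in S & G x y) ->
  exists p q, [/\ is_arc p, is_arc q & forall x, (x \in S) =
    [&& nonblocked x p, nonblocked x q
      & ~~ [exists y, [&& y \in S, y < x & G x y]]]].
Proof.
move=> free iS maxS; have iSP := independentP _ iS.
have nolow x : x \in S -> ~~ [exists y, [&& y \in S, y < x & G x y]].
  move=> xS; apply/existsPn => y; apply/negP => /and3P[yS _].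
  exact/negP/iSP.
have lowP x y : y \in S -> G x y -> y < x -> x \notin S ->
    (x \in S) = ~~ [exists y, [&& y \in S, y < x & G x y]].
  move=> yS xy yx /negbTE ->; apply/esym/negbTE; rewrite negbK.
  by apply/existsP; exists y; rewrite yS yx.
have le_lt x y : y \in S -> x \notin S -> y <= x -> y < x.
  by move=> yS xS; rewrite leq_eqVlt => /predU1P[/val_inj yx|//]; rewrite -yx yS in xS.
have [all_low|] := last_gap iS (fun x (_ : x \in setT) => maxS x).
  exists None, None; split=> // x; rewrite /=.
  have [xS|xS] := boolP (x \in S); first by rewrite nolow.
  have [//|y [yS xy yx]] := all_low x _ xS.
  by rewrite -(lowP x y) // (negbTE xS).
move=> [v [w [vS _ vw wlow good]]].
have nbv x : x \in S -> nonblocked x (Some (v, w)).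
  by move=> xS; apply/implyP => xv; rewrite iSP //= edge_sym wlow.
pose A := [set x : 'I_n | [&& x < v, ~~ G x v & ~~ G x w]].
have inA x : nonblocked x (Some (v, w)) -> x < v -> x \in A.
  by move=> /= /implyP + xv; rewrite inE xv; apply.
have iSA : independent G (S :&: A).
  by apply/independentP => x y /setIP[xS _] /setIP[yS _]; apply: iSP.
(* The neighbour in [S] given by [good] is not after [v], and is not [v] since [x] misses [v];
   members of [S] before [v] are unblocked, so it lies in [A]. *)
have maxSA x : x \in A -> x \notin S :&: A ->
    exists2 y, y \in S :&: A & G x y.
  move=> xA; rewrite inE xA andbT => xS.
  have [|y [yS xy]] := good x _ xS; first by rewrite inE.
  move: xA; rewrite inE => /and3P[xv xnv _].
  rewrite (maxn_idPr (ltnW xv)) => yv; exists y => //.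
  have ylt : y < v.
    by rewrite ltn_neqAle yv andbT; apply: contraNneq xnv => /val_inj <-.
  by rewrite inE yS inA // nbv.
have high x : x \notin S -> v <= x -> exists y, [/\ y \in S, G x y & y < x].
  move=> xS vx; have [|y [yS xy]] := good x _ xS; first by rewrite inE.
  by rewrite (maxn_idPl vx) => yx; exists y; split=> //; apply: le_lt.
have [all_low|] := last_gap iSA maxSA.
  exists (Some (v, w)), None; split=> // x; rewrite andTb.
  have [xS|xS] := boolP (x \in S); first by rewrite nbv ?nolow.
  apply/esym/negbTE/nandP; have [xv|vx] := ltnP x v; last first.
    have [y [yS xy yx]] := high x xS vx.
    by right; rewrite -(lowP x y).
  case: (boolP (nonblocked _ _)) => [nb|]; [right|by left].
  have [|y [/setIP[yS _] xy yx]] := all_low x (inA x nb xv).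
    by rewrite inE (negbTE xS).
  by rewrite -(lowP x y).
move=> [v' [w' [/setIP[v'S v'A] w'A vw' w'low good']]].
exists (Some (v, w)), (Some (v', w')); split=> // x.
have v'v : v' < v by move: v'A; rewrite inE => /and3P[].
have [xS|xS] := boolP (x \in S).
  rewrite nbv ?nolow // andbT; apply/esym/implyP => xv'.
  rewrite iSP //= edge_sym w'low // inE xS inA ?nbv //.
  exact: ltn_trans xv' v'v.
apply/esym/negbTE; rewrite !negb_and.
have [xv|vx] := ltnP x v; last first.
  have [y [yS xy yx]] := high x xS vx.
  by rewrite -(lowP x y) // xS !orbT.
case: (boolP (nonblocked x (Some (v, w)))) => //= nb; rewrite negbK.
have xA := inA x nb xv.
have [|y [/setIP[yS yA] xy yx]] := good' x xA; first by rewrite inE (negbTE xS).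
have [xv'|v'x] := ltnP x v'; last first.
  rewrite (maxn_idPl v'x) in yx.
  by apply/orP; right; apply/existsP; exists y; rewrite yS xy le_lt.
rewrite (maxn_idPr (ltnW xv')) in yx.
apply/orP; left; rewrite /=; apply/negP => /andP[xnv' xnw'].
have ylt : y < v'.
  by rewrite ltn_neqAle yx andbT; apply: contraNneq xnv' => /val_inj <-.
have ynv' : ~~ G y v' by apply: iSP.
have ynw' : ~~ G y w' by rewrite edge_sym w'low // inE yS.
have Anv z : z \in A -> G z v = false by rewrite inE => /and3P[_ /negbTE].
have Anw z : z \in A -> G z w = false by rewrite inE => /and3P[_ _ /negbTE].
(* All of [v'], [w'], [x], [y] lie in [A] and so miss [v] and [w]; [x] misses [v'] and [w'] as it is
   unblocked, [y] misses [v'] by independence and [w'] because it precedes the first neighbour [v']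
   of [w']. *)
have := free v w v' w' x y vw vw' xy => /=.
rewrite !Anv ?Anw // (negbTE xnv') (negbTE xnw') (negbTE ynv') (negbTE ynw').
by [].
Qed.

Variable e : rel nat.
(* [e] may be arbitrary on the diagonal: if [x = w] is tested against [w], then
   it is also tested against its neighbour [v]. *)
Hypothesis eG : forall x y : 'I_n, x != y -> e x y = G x y.

Let sel (v w v' w' : nat) :=
  greedy e (fun x : nat => blocked e v w x || blocked e v' w' x) n.

(** Whatever is blocked, a greedy set is independent, so the search never overshoots. *)
Lemma size_greedy_le_alpha blk : size (greedy e blk n) <= alpha G.
Proof.
pose S := [set x : 'I_n | val x \in greedy e blk n].
have -> : size (greedy e blk n) = #|S|.
  apply/esym/greedy_ord => x; rewrite inE (mem_greedy _ _ (ltn_ord x)); congr (~~ (_ || _)).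
  apply/hasP/existsP => [[y yx exy]|[y /and3P[]]].
    have ltyx := greedy_lt yx; exists (Ordinal (ltn_trans ltyx (ltn_ord x))).
    by rewrite inE /= ltyx exy (sub_greedy _ _ ltyx (ltnW (ltn_ord x))) yx.
  rewrite inE => yx ltyx exy; exists (val y) => //.
  by rewrite -(sub_greedy _ _ ltyx (ltnW (ltn_ord x))).
apply/card_le_alpha/independentP => x y; rewrite !inE => xg yg.
case: (ltngtP x y) => [xy|yx|/val_inj->]; last by rewrite edge_irr.
  rewrite edge_sym -eG; first exact: (greedy_indep yg xg xy).
  by rewrite -val_eqE gtn_eqF.
rewrite -eG; first exact: (greedy_indep xg yg yx).
by rewrite -val_eqE gtn_eqF.
Qed.

Lemma alpha_greedy : free_3K2 G -> 0 < n ->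
  exists v w v' w' : 'I_n, size (sel v w v' w') = alpha G.
Proof.
move=> free n0; have [S [iS <- maxS]] := alpha_maximal.
have [p [q [ap aq SP]]] := maximal_two_gaps free iS maxS.
(* A missing gap is encoded by vertex 0, before which no vertex can be blocked. *)
pose fst (p : option ('I_n * 'I_n)) := if p is Some (v, _) then v else Ordinal n0.
pose snd (p : option ('I_n * 'I_n)) := if p is Some (_, w) then w else Ordinal n0.
exists (fst p), (snd p), (fst q), (snd q); apply/esym/greedy_ord => x.
have nbE r : is_arc r -> nonblocked x r = ~~ blocked e (fst r) (snd r) x.
  case: r => [[v w]|] //= vw; rewrite /blocked negb_and negb_or implybE.
  have [xv|//] := ltnP x v; rewrite eG; last by rewrite -val_eqE ltn_eqF.
  have [->|xw] := eqVneq x w; last by rewrite eG.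
  by rewrite (edge_sym G w) vw.
rewrite SP !nbE // !negb_or andbA; congr (_ && ~~ _).
apply: eq_existsb => y; apply: andb_id2l => _; apply: andb_id2l => yx.
by rewrite eG // -val_eqE gtn_eqF.
Qed.

End Independent.

(** * Total correctness of random access programs *)

(* Relocatable code: a program fragment as a function of its start address. *)
Definition code := nat -> program.

Definition straight (s : program) : code := fun=> s.

Definition seqc (c1 c2 : code) : code :=
  fun o => c1 o ++ c2 (o + size (c1 o)).

Definition ifz j (c : code) : code :=
  fun o => Jump j (o.+1 + size (c o.+1)) :: c o.+1.

Definition dowhile (c : code) j : code := fun o => rcons (c o) (Jump j o).

(** Quantifying over the surrounding programs [L] and [R] makes the statement independent of where
    the fragment is placed. *)
Definition runs (c : code) t X Y := forall L R : program,
  iter t (step (L ++ c (size L) ++ R)) (size L, X)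
  = (size L + size (c (size L)), Y).

(** Weakest precondition for total correctness, with time budget [T]. *)
Definition wp (c : code) T (Q : registers -> Prop) X :=
  exists2 t, t <= T & exists2 Y, runs c t X Y & Q Y.

Definition is_jump a := if a is Jump _ _ then true else false.

Definition effect X a : registers := (exec a (0, X)).2.

Definition after X (s : program) : registers := foldl effect X s.
Arguments after : simpl never.

(** Rewriting with these equations executes straight code symbolically, one instruction at a
    time. *)
Lemma afterE X :
  (after X [::] = X) *
  (forall i c s, after X (Const i c :: s) = after (set_reg X i c) s) *
  (forall i j k s, after X (Add i j k :: s) = after (set_reg X i (X j + X k)) s) *
  (forall i j k s, after X (Sub i j k :: s) = after (set_reg X i (X j - X k)) s) *
  (forall i j s, after X (Get i j :: s) = after (set_reg X i (X (X j))) s) *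
  (forall i j s, after X (Put i j :: s) = after (set_reg X (X i) (X j)) s).
Proof. by []. Qed.

Lemma after_cat X s1 s2 : after X (s1 ++ s2) = after (after X s1) s2.
Proof. exact: foldl_cat. Qed.

Lemma set_regE X i v r : set_reg X i v r = if r == i then v else X r.
Proof. by []. Qed.

(** Frame condition: [D] lists the registers that may change. *)
Definition same_but (D : seq nat) (X Y : registers) :=
  forall r, r \notin D -> Y r = X r.

Lemma same_but_set D X Y i v :
  i \in D -> same_but D X Y -> same_but D X (set_reg Y i v).
Proof.
move=> iD XY r rD; rewrite set_regE XY //.
by case: eqP rD => // ->; rewrite iD.
Qed.

Lemma same_but_trans D X Y Z :
  same_but D X Y -> same_but D Y Z -> same_but D X Z.
Proof. by move=> XY YZ r rD; rewrite YZ ?XY. Qed.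

Lemma same_but_sub D D' X Y :
  {subset D <= D'} -> same_but D X Y -> same_but D' X Y.
Proof. by move=> sDD' XY r rD'; apply: XY; apply: contra rD' => /sDD'. Qed.

Lemma step_at L a R X :
  step (L ++ a :: R) (size L, X) = exec a (size L, X).
Proof. by rewrite /step onth_cat ltnn subnn. Qed.

Lemma wp_weaken c T1 T2 (Q1 Q2 : registers -> Prop) X :
  wp c T1 Q1 X -> T1 <= T2 -> (forall Y, Q1 Y -> Q2 Y) -> wp c T2 Q2 X.
Proof.
case=> t tT [Y run QY] le12 imp; exists t; first exact: leq_trans le12.
by exists Y => //; apply: imp.
Qed.

Lemma wp_seqc c1 c2 T1 T2 Q X :
  wp c1 T1 (wp c2 T2 Q) X -> wp (seqc c1 c2) (T1 + T2) Q X.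
Proof.
case=> t1 t1T [Y run1 [t2 t2T [Z run2 QZ]]].
exists (t2 + t1); first by rewrite addnC leq_add.
exists Z => // L R; rewrite iterD /seqc -catA run1 size_cat addnA.
by rewrite catA -size_cat run2.
Qed.

Lemma wp_straight s T Q X : ~~ has is_jump s -> size s <= T ->
  Q (after X s) -> wp (straight s) T Q X.
Proof.
move=> nj sT QX; exists (size s) => //; exists (after X s) => // L R.
rewrite /after; elim: s L X {QX sT} nj => [|a s IH] L X /=; first by rewrite addn0.
rewrite negb_or => /andP[ja js]; rewrite -iterS iterSr step_at.
have -> : exec a (size L, X) = (size (rcons L a), effect X a).
  by case: a ja => // *; rewrite size_rcons.
by rewrite -cat_rcons IH // size_rcons addSnnS.
Qed.

Lemma wp_straight_seqc s c T Q X : ~~ has is_jump s ->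
  wp c T Q (after X s) -> wp (seqc (straight s) c) (size s + T) Q X.
Proof. by move=> nj h; apply/wp_seqc/wp_straight. Qed.

Lemma wp_ifz j c T (Q : registers -> Prop) X :
  (X j = 0 -> wp c T Q X) -> (0 < X j -> Q X) -> wp (ifz j c) T.+1 Q X.
Proof.
move=> hz hp; have [Xj|Xj] := posnP (X j).
  have [t tT [Y run QY]] := hz Xj.
  exists t.+1 => //; exists Y => // L R.
  rewrite iterSr /ifz step_at /exec Xj ltnn.
  set a := Jump _ _; have := run (rcons L a) R.
  by rewrite size_rcons cat_rcons => ->; rewrite addSnnS.
exists 1 => //; exists X => [L R|]; last exact: hp.
by rewrite /= /ifz step_at /exec Xj addSnnS.
Qed.

(** The invariant is indexed by the number of completed turns, and register [j] must tell whether
    another one follows. The closing jump adds one step per turn. *)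
Lemma wp_dowhile c j T N (I : nat -> registers -> Prop) X :
  0 < N -> I 0 X ->
  (forall i Y, i < N -> I i Y ->
     wp c T (fun Z => I i.+1 Z /\ (0 < Z j) = (i.+1 < N)) Y) ->
  wp (dowhile c j) (N * T.+1) (I N) X.
Proof.
move=> N0 I0 body.
have turn t Y Z : runs c t Y Z -> forall L R,
    iter t.+1 (step (L ++ dowhile c j (size L) ++ R)) (size L, Y) =
    (if 0 < Z j then size L else size L + size (dowhile c j (size L)), Z).
  move=> run L R; rewrite iterS /dowhile cat_rcons run -size_cat catA step_at.
  by rewrite /exec size_cat size_rcons addnS.
suff H k i Y : i + k = N -> 0 < k -> I i Y -> wp (dowhile c j) (k * T.+1) (I N) Y.
  exact: (H N 0).
elim: k i Y => // k IH i Y eN _ IY.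
have iN : i < N by rewrite -eN -addSnnS leq_addr.
have [t tT [Z run [IZ Zj]]] := body i Y iN IY.
have [k0|k0] := posnP k.
  exists t.+1; first by rewrite k0 mul1n ltnS.
  move: eN; rewrite k0 addn1 => eN.
  exists Z => [L R|]; last by rewrite -eN.
  by rewrite (turn _ _ _ run) Zj eN ltnn.
have eN' : i.+1 + k = N by rewrite addSnnS.
have [t' t'T [Z' run' IZ']] := IH i.+1 Z eN' k0 IZ.
exists (t' + t.+1); first by rewrite mulSn addnC leq_add.
exists Z' => // L R; rewrite iterD (turn _ _ _ run) Zj -eN'.
by rewrite -[X in X < _]addn0 ltn_add2l k0 run'.
Qed.
(** * The search *)

(* Registers: 0 holds [n], 1 the constant 1, 2 the address [b] of the adjacency
   matrix, 3 the address [s] of the membership bits of the greedy set, 4 to 7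
   the tuple (v, w, v', w'), 8 the current vertex [x], 9 the address
   [b + x * n] of its row, 10 an earlier vertex, 11 a count that is zero iff
   [x] is selected, 12 the size of the greedy set, 13 the best size so far,
   and 14 and 15 are scratch. With [cmp] set, all adjacency bits are negated. *)
Section Search.
Variables (n b s : nat) (A : nat -> nat -> bool) (cmp : bool).
Hypotheses (n0 : 0 < n) (b16 : 16 <= b) (bs : b + n * n <= s).

Let e x y := A x y (+) cmp.

Definition bit_code : program := if cmp then [:: Sub 15 1 15] else [::].

Definition env (X : registers) :=
  [/\ X 0 = n, X 1 = 1, X 2 = b, X 3 = s &
    forall x y, x < n -> y < n -> X (b + x * n + y) = A x y].

(** The matrix ends before [s], so working registers 4 to 15 and the membership bits may change
    freely. *)
Lemma env_eq X Y : env X ->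
  (forall r, r < 4 \/ 16 <= r < s -> Y r = X r) -> env Y.
Proof.
case=> X0 X1 X2 X3 XA XY; split; rewrite ?XY //; try by left.
move=> x y xn yn; rewrite XY ?XA //; right.
rewrite -addnA (leq_trans b16 (leq_addr _ _)) (leq_trans _ bs) // ltn_add2l.
rewrite (@leq_trans (x * n + n)) ?ltn_add2l //.
by rewrite -mulSnr leq_mul2r xn orbT.
Qed.

Definition add_entry j : program :=
  [:: Add 14 9 j; Get 15 14] ++ bit_code ++ [:: Add 11 11 15].

Lemma add_entry_run X x j : j \in [:: 4; 5; 6; 7] -> env X ->
  x < n -> X j < n -> X 9 = b + x * n ->
  let Y := after X (add_entry j) in
  Y 11 = X 11 + e x (X j) /\ same_but [:: 11; 14; 15] X Y.
Proof.
move=> j4 [X0 X1 X2 X3 XA] xn jn X9 /=.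
have j14 : (j == 14) = false by move: j4; rewrite !inE => /or4P[]/eqP->.
have addr k : k < 16 -> (b + x * n + X j == k) = false.
  by move=> k16; rewrite gtn_eqF // -addnA (leq_trans k16) // (leq_trans b16) ?leq_addr.
rewrite /add_entry /bit_code /e; case: cmp => /=.
all: do !(rewrite afterE ?(set_regE, j14, addr, X9, X1, XA) //=).
all: split; last by do !apply: same_but_set.
all: by case: (A _ _).
Qed.

(** The truncated difference [x.+1 - v] vanishes exactly when [x < v], which is the guard in
    [blocked]. *)
Definition test_code i j : code :=
  seqc (straight [:: Add 14 8 1; Sub 14 14 i])
       (ifz 14 (straight (add_entry i ++ add_entry j))).

Lemma add_entry_jump i : has is_jump (add_entry i) = false.
Proof. by rewrite /add_entry /bit_code; case: cmp. Qed.

Lemma size_add_entry i : size (add_entry i) <= 4.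
Proof. by rewrite /add_entry /bit_code; case: cmp. Qed.

Lemma wp_test X x i j : i \in [:: 4; 5; 6; 7] -> j \in [:: 4; 5; 6; 7] ->
  env X -> x < n -> X i < n -> X j < n -> X 8 = x -> X 9 = b + x * n ->
  wp (test_code i j) 11 (fun Y =>
    Y 11 = X 11 + (if x < X i then e x (X i) + e x (X j) else 0) /\
    same_but [:: 11; 14; 15] X Y) X.
Proof.
move=> hi hj eX xn iN jN X8 X9.
have i14 : (i == 14) = false by move: hi; rewrite !inE => /or4P[]/eqP->.
(* Two instructions, then one jump and two matrix lookups of at most four instructions each. *)
rewrite -[11]/(2 + 9) /test_code.
apply: (wp_straight_seqc (s := [:: Add 14 8 1; Sub 14 14 i])) => //.
have X1 : X 1 = 1 by case: eX.
set Z := after X _.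
have [Z14 ZX] : Z 14 = x.+1 - X i /\ same_but [:: 11; 14; 15] X Z.
  rewrite /Z; do !rewrite afterE ?set_regE /= ?i14 ?X8 ?X1 ?addn1.
  by split=> //; do !apply: same_but_set.
have keep k : k \in [:: 4; 5; 6; 7] -> k \notin [:: 11; 14; 15].
  by rewrite !inE => /or4P[]/eqP->.
apply: wp_ifz; rewrite Z14; last first.
  by rewrite subn_gt0 ltnS leqNgt => /negbTE->; rewrite addn0.
move/eqP; rewrite subn_eq0 => xi; rewrite xi.
have eZ : env Z.
  by apply: env_eq eX _ => r hr; apply: ZX; rewrite !inE; lia.
have [Zi Zj Z9] : [/\ Z i = X i, Z j = X j & Z 9 = b + x * n].
  by rewrite !ZX // keep.
have [] := add_entry_run hi eZ xn; rewrite ?Zi // => Y11 YZ.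
have eY : env (after Z (add_entry i)).
  by apply: env_eq eZ _ => r hr; apply: YZ; rewrite !inE; lia.
have [Yj Y9] : after Z (add_entry i) j = X j /\ after Z (add_entry i) 9 = b + x * n.
  by rewrite !YZ // keep.
have [] := add_entry_run hj eY xn; rewrite ?Yj // => V11 VY.
apply: wp_straight.
- by rewrite has_cat !add_entry_jump.
- by rewrite size_cat (leq_add (size_add_entry _) (size_add_entry _)).
rewrite after_cat; split=> [|r hr]; first by rewrite V11 Y11 addnA.
by rewrite VY ?YZ ?ZX.
Qed.

(* The product of two bits is computed as their truncated sum minus 1. *)
Definition scan_code : code :=
  dowhile (straight ([:: Add 14 9 10; Get 15 14] ++ bit_code ++
    [:: Add 14 3 10; Get 14 14; Add 14 14 15; Sub 14 14 1; Add 11 11 14;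
        Add 10 10 1; Add 14 8 1; Sub 14 14 10])) 14.

Lemma wp_scan X x (f : pred nat) :
  env X -> x < n -> X 8 = x -> X 9 = b + x * n -> X 10 = 0 ->
  (forall y, y <= x -> X (s + y) = f y) ->
  wp scan_code (12 * x.+1) (fun Y =>
    Y 11 = X 11 + \sum_(y < x.+1) (f y && e x y) /\
    same_but [:: 10; 11; 14; 15] X Y) X.
Proof.
move=> eX xn X8 X9 X10 Xf.
pose I k (Y : registers) := [/\ Y 10 = k,
  Y 11 = X 11 + \sum_(y < k) (f y && e x y) & same_but [:: 10; 11; 14; 15] X Y].
apply: (@wp_weaken _ (x.+1 * 12) _ (I x.+1)); last 2 first.
- by rewrite mulnC.
- by move=> Y [].
apply: wp_dowhile => // [|k Y]; first by split; rewrite ?big_ord0 ?addn0.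
rewrite ltnS => kx [Y10 Y11 YX].
have [X0 X1 X2 X3 XA] := eX.
apply: wp_straight.
- by rewrite /bit_code; case: cmp.
- by rewrite /bit_code; case: cmp.
- rewrite /I big_ord_recr /= addnA -Y11.
  have Y1 : Y 1 = 1 by rewrite YX.
  have Y3 : Y 3 = s by rewrite YX.
  have Y8 : Y 8 = x by rewrite YX.
  have Y9 : Y 9 = b + x * n by rewrite YX.
  have YA : Y (b + x * n + k) = A x k.
    by rewrite YX ?XA ?(leq_ltn_trans kx) // !inE; lia.
  have Yf : Y (s + k) = f k by rewrite YX ?Xf // !inE; lia.
  have sk i : i < 16 -> (s + k == i) = false by lia.
  have bk i : i < 16 -> (b + x * n + k == i) = false by lia.
  have cond : (0 < x.+1 - k.+1) = (k.+1 < x.+1) by lia.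
  rewrite /bit_code /e; case: cmp => /=.
  all: do !(rewrite afterE ?(set_regE, sk, bk, Y1, Y3, Y8, Y9, Y10, YA, Yf) //= ?addn1).
  all: split=> //; split=> //; last by do !apply: same_but_set.
  all: by case: (A _ _) (f k) => [] [].
Qed.

(* The membership bit of [x] is cleared first, so that scanning all [y <= x]
   instead of [y < x] is harmless and the loop is never empty. *)
Definition place_code : code :=
  seqc (straight [:: Const 11 0; Add 14 3 8; Put 14 11])
  (seqc (test_code 4 5)
  (seqc (test_code 6 7)
  (seqc (straight [:: Const 10 0])
  (seqc scan_code
  (seqc (ifz 11 (straight [:: Add 14 3 8; Put 14 1; Add 12 12 1]))
        (straight [:: Add 8 8 1; Add 9 9 0; Sub 14 0 8])))))).

Definition selected v w v' w' :=
  greedy e (fun x => blocked e v w x || blocked e v' w' x).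

(** Invariant of the greedy pass once the vertices before [x] are treated; membership bits from [x]
    on may be leftovers of an earlier pass. *)
Definition placed best v w v' w' x (X : registers) :=
  let g := selected v w v' w' x in
  [/\ env X, [/\ X 4 = v, X 5 = w, X 6 = v' & X 7 = w'],
      [/\ X 8 = x, X 9 = b + x * n, X 12 = size g & X 13 = best] &
      forall y, y < x -> X (s + y) = (y \in g)].

Lemma wp_place best v w v' w' x X :
  v < n -> w < n -> v' < n -> w' < n -> x < n ->
  placed best v w v' w' x X ->
  wp place_code (33 + 12 * n) (fun Y => placed best v w v' w' x.+1 Y /\
    (0 < Y 14) = (x.+1 < n)) X.
Proof.
move=> vn wn vn' wn' xn [eX [X4 X5 X6 X7] [X8 X9 X12 X13] Xs].
set g := selected v w v' w' x in X12 Xs.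
have s16 : 16 <= s by apply: leq_trans b16 (leq_trans (leq_addr _ _) bs).
have sk k i : i < 16 -> (s + k == i) = false by lia.
have ks k i : i < 16 -> (i == s + k) = false by lia.
apply: (@wp_weaken _ (3 + (11 + (11 + (1 + (12 * x.+1 + (4 + 3)))))));
  [|by lia|by move=> Y; apply].
apply: wp_straight_seqc => //; set X0 := after X _.
have [X00 X01 X02 X03 _] := eX.
have [B11 Bs BX] : [/\ X0 11 = 0, X0 (s + x) = 0 &
    same_but [:: 11; 14; s + x] X X0].
  rewrite /X0; do !rewrite afterE ?(set_regE, eqxx, ks, sk) //= ?X03 ?X8.
  by split=> //; do !apply: same_but_set; rewrite ?inE ?eqxx ?orbT.
have e0 : env X0.
  by apply: env_eq eX _ => r hr; apply: BX; rewrite !inE; lia.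
have BXc r : r < 16 -> r != 11 -> r != 14 -> X0 r = X r.
  by move=> r16 r11 r14; apply: BX; rewrite !inE ks // orbF negb_or r11.
apply: wp_seqc.
apply: (@wp_weaken _ 11 11); [apply: (@wp_test _ x)|by []|move=> X1 [C11 CX]];
  rewrite ?BXc ?X4 ?X5 //.
rewrite B11 BXc // BXc // X4 X5 add0n in C11.
have e1 : env X1 by apply: env_eq e0 _ => r hr; apply: CX; rewrite !inE; lia.
have CXc r : r < 16 -> r != 11 -> r != 14 -> r != 15 -> X1 r = X r.
  move=> r16 r11 r14 r15; rewrite CX ?BXc // !inE.
  by rewrite !negb_or r11 r14.
apply: wp_seqc.
apply: (@wp_weaken _ 11 11); [apply: (@wp_test _ x)|by []|move=> X2 [D11 DX]];
  rewrite ?CXc ?X6 ?X7 //.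
rewrite C11 CXc // CXc // X6 X7 in D11.
have e2 : env X2 by apply: env_eq e1 _ => r hr; apply: DX; rewrite !inE; lia.
have DXc r : r < 16 -> r != 11 -> r != 14 -> r != 15 -> X2 r = X r.
  move=> r16 r11 r14 r15; rewrite DX ?CXc // !inE.
  by rewrite !negb_or r11 r14.
have DXs y : y <= x -> X2 (s + y) = (y \in g).
  move=> yx; rewrite DX ?CX ?inE ?sk //.
  move: yx; rewrite leq_eqVlt => /predU1P[->|yx].
    by rewrite Bs; case: (boolP (x \in g)) => // /greedy_lt; rewrite ltnn.
  by rewrite BX ?Xs // !inE (sk _ 11) // (sk _ 14) // eqn_add2l ltn_eqF.
apply: wp_straight_seqc => //; set X3 := after X2 _.
have E11 : X3 11 = X2 11 by [].
have EX : same_but [:: 10] X2 X3 by apply: same_but_set.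
have e3 : env X3 by apply: env_eq e2 _ => r hr; apply: EX; rewrite !inE; lia.
apply: wp_seqc.
apply: (@wp_weaken _ (12 * x.+1) (12 * x.+1));
  [apply: (@wp_scan _ x (mem g))|by []|move=> X4' [F11 FX]] => //.
- by rewrite EX ?DXc.
- by rewrite EX ?DXc.
- by move=> y yx; rewrite EX ?DXs // inE sk.
have e4 : env X4' by apply: env_eq e3 _ => r hr; apply: FX; rewrite !inE; lia.
have FXc r : r < 16 -> r \notin [:: 10; 11; 14; 15] -> X4' r = X r.
  move=> r16 hr; rewrite FX // EX ?DXc //; move: hr; rewrite !inE; lia.
have FXs y : y <= x -> X4' (s + y) = (y \in g).
  by move=> yx; rewrite FX ?EX ?DXs // !inE ?sk.
(* Register 11 sums one count for each reason to skip [x], so it vanishes exactly when none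
   applies. *)
have next : (X4' 11 == 0) = (x \in selected v w v' w' x.+1).
  rewrite /selected mem_greedyS eqxx F11 E11 D11 /blocked !addn_eq0 !negb_or.
  congr (_ && _); last first.
    rewrite sum_nat_eq0; apply/forallP/hasPn => h.
      move=> y yg; have yx := greedy_lt yg.
      by have := h (Ordinal (ltnW yx : y < x.+1)); rewrite /= yg; case: (e x y).
    move=> y; apply/implyP => _; case: (boolP (val y \in g)) => [/h/negbTE/= ->|].
      by rewrite andbF.
    by move=> /negbTE /= ->.
  by congr (_ && _); case: ifP => // _; rewrite addn_eq0; case: (e _ _); case: (e _ _).
apply: wp_seqc.
have [X10 X11 X12' X13' _] := e4.
(* Both outcomes of the conditional continue with the same updates, treated here once. *)
have finish Y : (forall r, r != 12 -> r != 14 -> r != s + x -> Y r = X4' r) ->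
    Y (s + x) = (x \in selected v w v' w' x.+1) ->
    Y 12 = size (selected v w v' w' x.+1) ->
    wp (straight [:: Add 8 8 1; Add 9 9 0; Sub 14 0 8]) 3
      (fun Y => placed best v w v' w' x.+1 Y /\ (0 < Y 14) = (x.+1 < n)) Y.
  move=> YX Ys Y12.
  have YXc r : r < 16 -> r \notin [:: 10; 11; 12; 14; 15] -> Y r = X r.
    by move=> r16 hr; rewrite YX ?FXc //; move: hr; rewrite !inE; lia.
  apply: wp_straight => //; set Z := after _ _.
  have [Z8 Z9 Z14 ZY] : [/\ Z 8 = x.+1, Z 9 = b + x.+1 * n, Z 14 = n - x.+1 &
      same_but [:: 8; 9; 14] Y Z].
    rewrite /Z; do !rewrite afterE ?set_regE /= ?YXc // ?X8 ?X9 ?X00 ?X01 ?addn1.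
    by split; rewrite ?mulSnr ?addnA //; do !apply: same_but_set.
  split; last by rewrite Z14 subn_gt0.
  split=> //; first last.
  - move=> y; rewrite ltnS leq_eqVlt ZY ?inE ?sk // => /predU1P[->//|yx].
    rewrite YX ?eqn_add2l ?(ltn_eqF yx) ?sk // FXs ?(ltnW yx) //.
    by rewrite /selected mem_greedyS (ltn_eqF yx).
  - by split=> //; rewrite ZY // YXc.
  - by split; rewrite ZY // YXc.
  apply: env_eq e4 _ => r hr; rewrite ZY ?YX // ?inE; lia.
have F8 : X4' 8 = x by rewrite FXc.
have F12 : X4' 12 = size g by rewrite FXc.
apply: wp_ifz => [F0|F0].
  apply: wp_straight => //; apply: finish.
  - move=> r /negbTE r12 /negbTE r14 /negbTE rs.
    by do !rewrite afterE ?set_regE /= ?X13' ?F8 ?r12 ?rs ?r14.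
  - rewrite -next F0 eqxx.
    by do !rewrite afterE ?(set_regE, eqxx, sk, ks) //= ?X13' ?X11 ?F8.
  transitivity (size g).+1.
    by do !rewrite afterE ?(set_regE, eqxx, sk, ks) //= ?X13' ?X11 ?F8 ?F12 ?addn1.
  move: next; rewrite F0 eqxx => /esym.
  by rewrite /selected mem_greedyS eqxx /= => /negbTE ->.
apply: finish => //.
  rewrite FXs // -next gtn_eqF //.
  by apply/eqP; rewrite eqb0; apply/negP => /greedy_lt; rewrite ltnn.
rewrite FXc // X12; move: next; rewrite gtn_eqF // => /esym.
by rewrite /selected mem_greedyS eqxx /= => /negbT; rewrite negbK => ->.
Qed.

(** The last two instructions take a maximum, as [m + (k - m)] with truncated subtraction is
    [maxn m k]. *)
Definition greedy_code : code :=
  seqc (straight [:: Const 8 0; Const 9 0; Add 9 9 2; Const 12 0])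
  (seqc (dowhile place_code 14) (straight [:: Sub 14 12 13; Add 13 13 14])).

(* Registers [4, ..., 7] hold the loop variables; the code of a loop body may
   change anything else, but updates the maximum in register [13]. *)
Definition improves i (f : registers -> nat) (X Y : registers) :=
  [/\ env Y, forall r, 4 <= r < i -> Y r = X r & Y 13 = maxn (X 13) (f X)].

Definition bounded i (X : registers) := forall r, 4 <= r < i -> X r < n.

Lemma wp_greedy X : env X -> bounded 8 X ->
  wp greedy_code (6 + n * (34 + 12 * n))
    (improves 8 (fun Y => size (selected (Y 4) (Y 5) (Y 6) (Y 7) n)) X) X.
Proof.
move=> eX X4.
apply: (@wp_weaken _ (4 + (n * (34 + 12 * n) + 2)));
  [|by lia|by move=> Y; apply].
have [X0 X1 X2 X3 XA] := eX.
apply: wp_straight_seqc => //; set Y := after X _.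
have [Y8 Y9 Y12 YX] : [/\ Y 8 = 0, Y 9 = b, Y 12 = 0 & same_but [:: 8; 9; 12] X Y].
  rewrite /Y; do !rewrite afterE ?set_regE /= ?X2 ?add0n.
  by split=> //; do !apply: same_but_set.
apply: wp_seqc.
apply: (@wp_weaken _ (n * (33 + 12 * n).+1) _
    (placed (X 13) (X 4) (X 5) (X 6) (X 7) n)); last 2 first.
- by [].
- move=> Z [eZ [Z4 Z5 Z6 Z7] [_ _ Z12 Z13] _]; apply: wp_straight => //.
  set V := after Z _.
  have [V13 VZ] : V 13 = maxn (Z 13) (Z 12) /\ same_but [:: 13; 14] Z V.
    rewrite /V; do !rewrite afterE ?set_regE /=.
    by split; [rewrite maxnE | do !apply: same_but_set].
  split; last by rewrite V13 Z13 Z12.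
    by apply: env_eq eZ _ => r hr; apply: VZ; rewrite !inE; lia.
  by case=> [|[|[|[|[|[|[|[|r]]]]]]]] // _; rewrite VZ.
apply: wp_dowhile => //.
  split=> //; last by split=> //; rewrite ?Y9 ?addn0 ?YX.
  by apply: env_eq eX _ => r hr; apply: YX; rewrite !inE; lia.
by move=> x Z xn; apply: wp_place => //; apply: X4.
Qed.

(** * Nested loops over the blocking tuples *)

Definition for_code i (c : code) : code :=
  seqc (straight [:: Const i 0])
       (dowhile (seqc c (straight [:: Add i i 1; Sub 14 0 i])) 14).

(** Each turn improves the maximum by [f] at the current loop variable. Since [f] depends only on
    registers 4 to [i], it can be evaluated on the registers before the loop. *)
Lemma wp_for i c T f X : 4 <= i < 8 ->
  (forall Y, env Y -> bounded i.+1 Y -> wp c T (improves i.+1 f Y) Y) ->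
  (forall Y Z, (forall r, 4 <= r <= i -> Y r = Z r) -> f Y = f Z) ->
  env X -> bounded i X ->
  wp (for_code i c) (1 + n * (T + 3))
    (improves i (fun Y => \max_(v < n) f (set_reg Y i v)) X) X.
Proof.
move=> i4 body eqf eX bX.
apply: wp_straight_seqc => //; set X' := after X _.
have X'X : same_but [:: i] X X' by apply: same_but_set; rewrite ?mem_head.
have X'i : X' i = 0 by rewrite /X' !afterE set_regE eqxx.
pose I k (Y : registers) := [/\ env Y, forall r, 4 <= r < i -> Y r = X r, Y i = k &
  Y 13 = maxn (X 13) (\max_(v < k) f (set_reg X i v))].
apply: (@wp_weaken _ (n * (T + 2).+1) _ (I n)); last 2 first.
- by rewrite -addnS.
- by move=> Y [].
apply: wp_dowhile => //.
  split=> //; first by apply: env_eq eX _ => r hr; apply: X'X; rewrite inE; lia.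
    by move=> r hr; apply: X'X; rewrite inE; lia.
  by rewrite big_ord0 maxn0 X'X // inE; lia.
move=> k Y kn [eY YX Yi Y13].
apply: wp_seqc; apply: (@wp_weaken _ T T); [apply: body|by []|] => //.
  move=> r /andP[r4]; rewrite ltnS leq_eqVlt => /predU1P[->|ri].
    by rewrite Yi.
  by rewrite YX ?r4 // bX ?r4.
move=> Z [eZ ZY Z13]; apply: wp_straight => //; set V := after Z _.
have [Z0 Z1 Z2 Z3 _] := eZ.
have [Vi V14 VZ] : [/\ V i = k.+1, V 14 = n - k.+1 & same_but [:: i; 14] Z V].
  have i14 : (i == 14) = false by lia.
  have i0 : (0 == i) = false by lia.
  have Zi : Z i = k by rewrite ZY ?Yi //; lia.
  rewrite /V; do !rewrite afterE ?(set_regE, eqxx, i14, i0) /= ?Zi ?Z1 ?Z0 ?addn1.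
  by split=> //; do !apply: same_but_set; rewrite ?inE ?eqxx ?orbT.
split; last by rewrite V14 subn_gt0.
split=> //.
- by apply: env_eq eZ _ => r hr; apply: VZ; rewrite !inE; lia.
- by move=> r hr; rewrite VZ ?ZY ?YX // ?inE; lia.
rewrite VZ ?inE; last by lia.
rewrite Z13 Y13 big_ord_recr /= maxnA; congr maxn; apply: eqf => r hr.
by rewrite set_regE; case: eqP => [->|ri]; [|apply: YX; lia].
Qed.

Definition search_code : code :=
  for_code 4 (for_code 5 (for_code 6 (for_code 7 greedy_code))).

Lemma wp_search X : env X ->
  wp search_code (1 + n * ((1 + n * ((1 + n * ((1 + n * ((6 + n * (34 + 12 * n)) + 3)) + 3)) + 3)) + 3))
    (fun Y => env Y /\ Y 13 = maxn (X 13)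
      (\max_(v < n) \max_(w < n) \max_(v' < n) \max_(w' < n)
         size (selected v w v' w' n))) X.
Proof.
move=> eX; apply: (wp_weaken (Q1 := improves 4 _ X)); last 2 first.
- exact: leqnn.
- by move=> Y [eY _ ->].
apply: (wp_for _ _ (f := fun Y => \max_(w < n) \max_(v' < n) \max_(w' < n)
    size (selected (Y 4) w v' w' n))) => //; last 2 first.
- by move=> Y Z YZ; rewrite YZ.
- by move=> r; lia.
move=> Y eY bY.
apply: (wp_for _ _ (f := fun Y => \max_(v' < n) \max_(w' < n)
    size (selected (Y 4) (Y 5) v' w' n))) eY bY => //; last first.
  by move=> U V UV; rewrite !UV.
move=> Z eZ bZ.
apply: (wp_for _ _ (f := fun Y => \max_(w' < n)
    size (selected (Y 4) (Y 5) (Y 6) w' n))) eZ bZ => //; last first.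
  by move=> U V UV; rewrite !UV.
move=> U eU bU.
apply: (wp_for _ _ (f := fun Y => size (selected (Y 4) (Y 5) (Y 6) (Y 7) n)))
  eU bU => //; last first.
  by move=> V W VW; rewrite !VW.
exact: wp_greedy.
Qed.

End Search.

(** * Moving the input out of the working registers *)

(* No register is free at the start except 1, which holds a diagonal entry, so
   the bits in registers 2 to 4 are first packed into register 1; this leaves
   enough room to compute [M = 15 + n * n], and then register [r] can be copied
   to [M + r]. *)
Section Relocation.
Variables (n : nat) (a : pred nat).
Hypothesis n0 : 0 < n.

(** The bits get weights 4, 2 and 1, and [n * n] is obtained by adding [n] repeatedly. *)
Definition pack_code : code :=
  seqc (straight [:: Add 1 2 2; Add 1 1 3; Add 1 1 1; Add 1 1 4;
                     Const 2 15; Const 3 0; Add 3 3 0; Const 4 1])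
       (dowhile (straight [:: Add 2 2 0; Sub 3 3 4]) 3).

Lemma wp_pack X : X 0 = n -> (forall r, 0 < r -> X r = a r) ->
  wp pack_code (8 + n * 3) (fun Y =>
    [/\ Y 0 = n, Y 1 = a 2 * 4 + a 3 * 2 + a 4, Y 2 = 15 + n * n, Y 4 = 1 &
      forall r, 4 < r -> Y r = a r]) X.
Proof.
move=> X0 Xa; apply: wp_straight_seqc => //; set Y := after X _.
have [[Y1 Y2 Y3 Y4] YX] : [/\ Y 1 = a 2 * 4 + a 3 * 2 + a 4, Y 2 = 15, Y 3 = n
    & Y 4 = 1] /\ same_but [:: 1; 2; 3; 4] X Y.
  rewrite /Y; do !rewrite afterE ?set_regE /= ?X0 ?Xa //.
  split; last by do !apply: same_but_set.
  by split=> //; case: (a 2) (a 3) (a 4) => [] [] [].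
pose I k (Z : registers) := [/\ Z 2 = 15 + k * n, Z 3 = n - k &
  same_but [:: 2; 3] Y Z].
apply: (@wp_weaken _ (n * 3) _ (I n)) => [||Z [Z2 _ ZY]]; last 2 first.
- by [].
- split=> //; try by rewrite ZY // YX.
  by move=> r r4; rewrite ZY ?YX ?Xa ?(leq_trans _ r4) // !inE; lia.
apply: wp_dowhile => // [|k Z kn [Z2 Z3 ZY]].
  by split; rewrite ?addn0 ?subn0.
apply: wp_straight => //; rewrite /I.
do !rewrite afterE ?set_regE /= ?Z2 ?Z3.
rewrite !ZY // YX // X0 Y4 subn1 -subnS subn_gt0; split=> //.
by split; [rewrite mulSnr addnA | | do !apply: same_but_set].
Qed.

End Relocation.

Section Saving.
Variable M : nat.
Hypothesis M15 : 15 < M.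

(** Each register gets its own instructions, since a loop would occupy registers still to be
    saved. *)
Definition save rs : program :=
  flatten [seq [:: Const 3 r; Add 3 3 2; Put 3 r] | r <- rs].

Lemma save_run rs X : all (fun r => 3 < r < 16) rs -> uniq rs -> X 2 = M ->
  let Y := after X (save rs) in
  same_but (3 :: [seq M + r | r <- rs]) X Y /\
  {in rs, forall r, Y (M + r) = X r}.
Proof.
elim: rs X => [|r rs IH] X //= /andP[r4 rs4] /andP[rrs urs] X2.
rewrite -[save _]/([:: Const 3 r; Add 3 3 2; Put 3 r] ++ save rs) after_cat.
set Y := after X _.
have [r3 M3] : (r == 3) = false /\ (M + r == 3) = false by lia.
have M2 : (2 == M + r) = false by lia.
have [Y2 Yr YX] : [/\ Y 2 = M, Y (M + r) = X r & same_but [:: 3; M + r] X Y].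
  rewrite /Y; do !rewrite afterE ?(set_regE, eqxx, r3) /= ?X2 ?(addnC r).
  rewrite M2; split=> //.
  by do !apply: same_but_set; rewrite ?inE ?eqxx ?orbT.
have [ZY Zr] := IH Y rs4 urs Y2; split=> [k|k].
  rewrite !inE !negb_or => /and3P[k3 kr krs].
  by rewrite ZY ?YX // !inE negb_or k3.
have YXs j : 3 < j < 16 -> Y j = X j.
  by move=> hj; rewrite YX // !inE; lia.
rewrite inE => /predU1P[->|krs]; last by rewrite Zr ?YXs ?(allP rs4).
rewrite ZY // inE M3 mem_map //; exact: addnI.
Qed.

(** If register 1 holds [c * w + d] with [d < w], subtracting [w.-1] leaves a positive number
    exactly when [c] is 1; two subtractions from 1 turn this into the bit. Subtracting the bit [w]
    times leaves [d]. *)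
Definition decode_bit k w : program :=
  [:: Const 5 w.-1; Sub 5 1 5; Sub 5 4 5; Sub 5 4 5;
      Const 3 k; Add 3 3 2; Put 3 5] ++ nseq w (Sub 1 1 5).

Lemma decode_bit_run X k w (c : bool) d :
  d < w -> X 1 = c * w + d -> X 2 = M -> X 4 = 1 ->
  let Y := after X (decode_bit k w) in
  [/\ Y 1 = d, Y (M + k) = c & same_but [:: 1; 3; 5; M + k] X Y].
Proof.
move=> dw X1 X2 X4; rewrite /decode_bit after_cat; set Y := after X _.
have big i : i < 16 -> (M + k == i) = false by lia.
have big' i : i < 16 -> (i == M + k) = false by lia.
have c1 : 1 - (1 - (c * w + d - w.-1)) = c by case: c {X1}; lia.
have [Y1 Yk Y5 YX] : [/\ Y 1 = X 1, Y (M + k) = c, Y 5 = c &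
    same_but [:: 1; 3; 5; M + k] X Y].
  rewrite /Y; do 4!rewrite afterE ?set_regE /= ?X1 ?X4 ?c1.
  do !rewrite afterE ?(set_regE, eqxx) /= ?X2 ?(addnC k) ?big' //.
  by split=> //; do !apply: same_but_set; rewrite ?inE ?eqxx ?orbT.
have subs j (Z : registers) : Z 5 = c :> nat -> let V := after Z (nseq j (Sub 1 1 5)) in
    V 1 = Z 1 - j * c /\ same_but [:: 1] Z V.
  elim: j Z => [|j IH] Z Z5 /=; first by rewrite afterE subn0.
  rewrite afterE Z5; have [] := IH (set_reg Z 1 (Z 1 - c)) Z5.
  move=> -> VZ; rewrite set_regE /= -subnDA -mulSn; split=> //.
  by apply: same_but_trans VZ; apply: same_but_set.
have [V1 VY] := subs w Y Y5; split.
- by rewrite V1 Y1 X1 mulnC addKn.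
- by rewrite VY // inE big.
by apply: same_but_trans YX (same_but_sub _ VY) => r; rewrite !inE => ->.
Qed.

(** The copy of register 1, overwritten by packing, is the diagonal entry 0. Then the source and
    target pointers of the copying loop are set. *)
Definition decode_tail : program :=
  [:: Const 5 0; Add 3 2 4; Put 3 5; Const 5 16; Const 3 16; Add 3 3 2].

Definition decode : program :=
  decode_bit 2 4 ++ decode_bit 3 2 ++ decode_bit 4 1 ++
  decode_tail.

Lemma after_decode X : after X decode =
  after (after (after (after X (decode_bit 2 4)) (decode_bit 3 2))
    (decode_bit 4 1)) decode_tail.
Proof. by rewrite /decode; do 3!rewrite [LHS]after_cat. Qed.

Lemma decode_run X (a2 a3 a4 : bool) :
  X 1 = a2 * 4 + a3 * 2 + a4 -> X 2 = M -> X 4 = 1 ->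
  let Y := after X decode in
  [/\ Y 5 = 16, Y 3 = M + 16,
    [/\ Y (M + 1) = 0, Y (M + 2) = a2, Y (M + 3) = a3 & Y (M + 4) = a4] &
    same_but [:: 1; 3; 5; M + 1; M + 2; M + 3; M + 4] X Y].
Proof.
move=> X1 X2 X4; rewrite after_decode.
have big k i : i < 16 -> (M + k == i) = false by lia.
have big' k i : i < 16 -> (i == M + k) = false by lia.
have d4 : a3 * 2 + a4 < 4 by case: a3 a4 {X1} => [] [].
have d3 : a4 < 2 by case: a4 {X1 d4}.
rewrite -addnA in X1.
case: (decode_bit_run 2 d4 X1 X2 X4); move: (after X _) => Y Y1 Ya YX.
have [Y2 Y4] : Y 2 = M /\ Y 4 = 1 by rewrite !YX // !inE big'.
case: (decode_bit_run 3 d3 Y1 Y2 Y4); move: (after Y _) => Z Z1 Za ZY.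
have [Z2 Z4] : Z 2 = M /\ Z 4 = 1 by rewrite !ZY // !inE big'.
have Z1' : Z 1 = a4 * 1 + 0 by rewrite Z1 muln1 addn0.
case: (decode_bit_run 4 (ltn0Sn 0) Z1' Z2 Z4); move: (after Z _) => V V1 Va VZ.
have V2 : V 2 = M by rewrite VZ // !inE big'.
have V4 : V 4 = 1 by rewrite VZ // !inE big'.
set U := after V _.
have [U5 U3 Ua UV] : [/\ U 5 = 16, U 3 = M + 16, U (M + 1) = 0 &
    same_but [:: 3; 5; M + 1] V U].
  rewrite /U; do !rewrite afterE ?(set_regE, eqxx) /= ?big ?big' ?V2 ?V4 ?(addnC 16) //.
  by split=> //; do !apply: same_but_set; rewrite ?inE ?eqxx ?orbT.
split=> //; first split=> //.
- by rewrite UV ?VZ ?ZY // !inE; lia.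
- by rewrite UV ?VZ // !inE; lia.
- by rewrite UV // !inE; lia.
move=> r; rewrite !inE !negb_or => /and5P[r1 r3 r5 rM1 /and3P[rM2 rM3 rM4]].
by rewrite UV ?VZ ?ZY ?YX // !inE !negb_or ?r1 ?r3 ?r5.
Qed.

End Saving.

(** * Copying the matrix and setting up the search environment *)

Section Preparation.
Variables (n : nat) (a : pred nat).
Hypotheses (n0 : 0 < n) (a1 : a 1 = false).

Definition copy_code : code :=
  dowhile (straight [:: Get 6 5; Put 3 6; Add 5 5 4; Add 3 3 4;
                        Add 6 2 4; Sub 6 6 5]) 6.

(** Matrix entries are numbered from 1, so their copies start at [M + 1]; the membership bits start
    at [2 * M + 1], beyond all copies. *)
Definition prepare_code : code :=
  seqc pack_code
  (seqc (straight (save (iota 5 11)))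
  (seqc (straight decode)
  (seqc copy_code
        (straight [:: Const 1 1; Add 3 2 2; Add 2 2 1; Add 3 3 1; Const 13 0])))).

(** The loop copies registers 16 to [M], exactly [n * n] of them and hence at least one; all targets
    exceed [M], so no source is overwritten. *)
Let M := 15 + n * n.

Lemma wp_copy X : X 5 = 16 -> X 3 = M + 16 -> X 2 = M -> X 4 = 1 ->
  (forall r, 0 < r < 16 -> X (M + r) = a r) ->
  (forall r, 16 <= r <= M -> X r = a r) ->
  wp copy_code (n * n * 7) (fun Y =>
    [/\ Y 0 = X 0, Y 2 = M & forall r, 0 < r <= M -> Y (M + r) = a r]) X.
Proof.
move=> X5 X3 X2 X4 XM Xa.
have nn0 : 0 < n * n by rewrite muln_gt0 n0.
pose I k (Y : registers) := [/\ [/\ Y 5 = 16 + k, Y 3 = M + (16 + k), Y 2 = M,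
  Y 4 = 1 & Y 0 = X 0], forall r, 0 < r < 16 + k -> Y (M + r) = a r &
  forall r, 16 <= r <= M -> Y r = a r].
apply: (@wp_weaken _ (n * n * 7) _ (I (n * n))) => // [|Y [[_ _ Y2 _ Y0] YM _]];
  last by split=> // r hr; apply: YM; rewrite /M in hr; lia.
apply: wp_dowhile => // k Y kn [[Y5 Y3 Y2 Y4 Y0] YM Ya].
have M16 : 15 < M by rewrite /M; lia.
have kM : 16 + k <= M by rewrite /M; lia.
pose p := 16 + k; have pE : p = 16 + k by [].
rewrite -/p in Y5 Y3 YM kM; clearbody p.
have p16 : 16 <= p by lia.
have big i : i < 16 -> (M + p == i) = false by lia.
have big' i : i < 16 -> (i == M + p) = false by lia.
have bp i : i < 16 -> (p == i) = false by lia.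
apply: wp_straight => //; set Z := after Y _.
have [[Z3 Z5 Z6 Zp] ZY] : [/\ Z 3 = M + p + 1, Z 5 = p + 1, Z 6 = M + 1 - (p + 1)
    & Z (M + p) = a p] /\ same_but [:: 3; 5; 6; M + p] Y Z.
  rewrite /Z.
  do !rewrite afterE ?(set_regE, eqxx) /= ?Y2 ?Y3 ?Y4 ?Y5 ?big ?big' ?bp ?Ya ?p16 //.
  by split; [split|do !apply: same_but_set; rewrite ?inE ?eqxx ?orbT].
rewrite /I; split; last by rewrite Z6 subn_gt0 pE /M; lia.
split.
- rewrite Z5 Z3 !ZY ?inE ?big' //; split=> //; lia.
- move=> r /andP[r0 rp]; have [->//|rp'] := eqVneq r p.
  by rewrite ZY ?YM // ?inE; lia.
by move=> r hr; rewrite ZY ?Ya // !inE; lia.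
Qed.

Lemma wp_prepare X : X 0 = n -> (forall r, 0 < r -> X r = a r) ->
  wp prepare_code (80 + n * 3 + n * n * 7) (fun Y =>
    env n (16 + n * n) (31 + 2 * (n * n)) (fun x y => a (x * n + y).+1) Y
    /\ Y 13 = 0) X.
Proof.
move=> X0 Xa.
(* Saving eleven registers takes 33 instructions and decoding takes 34. *)
apply: (@wp_weaken _ (8 + n * 3 + (33 + (34 + (n * n * 7 + 5))))); [|by lia|by move=> Y; apply].
apply: wp_seqc; apply: (wp_weaken (wp_pack n0 X0 Xa)) => // Y [Y0 Y1 Y2 Y4 Ya].
rewrite -/M in Y2.
have M16 : 15 < M by rewrite /M; lia.
have [|||ZY ZM] := @save_run M M16 (iota 5 11) Y => //.
apply: (@wp_straight_seqc (save (iota 5 11))) => //.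
move: (after Y (save _)) ZY ZM => Z ZY ZM.
have MZ k i : i < 15 -> (i == M + k) = false by lia.
have Zlow r : r < 16 -> r != 3 -> Z r = Y r.
  move=> r16 r3; apply: ZY; rewrite inE negb_or r3 andTb.
  by apply/mapP => -[k _]; lia.
have [|||V5 V3 [Va1 Va2 Va3 Va4] VZ] := @decode_run M M16 Z (a 2) (a 3) (a 4).
- by rewrite Zlow.
- by rewrite Zlow.
- by rewrite Zlow.
apply: (@wp_straight_seqc decode) => //.
move: (after Z decode) V5 V3 Va1 Va2 Va3 Va4 VZ => V V5 V3 Va1 Va2 Va3 Va4 VZ.
apply: wp_seqc.
apply: (wp_weaken (wp_copy V5 V3 _ _ _ _)) => //.
- by rewrite VZ ?Zlow // !inE !MZ.
- by rewrite VZ ?Zlow // !inE !MZ.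
- move=> r /andP[r0 r16].
  have [r5|r5] := leqP 5 r.
    rewrite VZ; last by rewrite !inE; lia.
    by rewrite ZM ?Ya ?mem_iota //; lia.
  by case: r r0 r5 {r16} => [|[|[|[|[|r]]]]] // _ _; rewrite ?Va1 ?a1.
- move=> r /andP[r16 rM].
  rewrite VZ ?ZY ?Ya //; try lia.
    by rewrite inE negb_or; apply/andP; split; [lia|apply/mapP => -[k]; rewrite mem_iota; lia].
  by rewrite !inE; lia.
move=> U [U0 U2 Ua]; apply: wp_straight => //; set W := after U _.
have U0n : U 0 = n by rewrite U0 VZ ?Zlow ?Y0 // !inE !MZ.
have [[W1 W2 W3 W13] WU] : [/\ W 1 = 1, W 2 = M + 1, W 3 = M + M + 1 & W 13 = 0]
    /\ same_but [:: 1; 2; 3; 13] U W.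
  rewrite /W; do !rewrite afterE ?set_regE /= ?U2.
  by split; [split|do !apply: same_but_set].
split=> //; split=> //.
- by rewrite W2 /M; lia.
- by rewrite W3 /M; lia.
move=> x y xn yn.
have xy : (x * n + y).+1 <= n * n by nia.
have -> : 16 + n * n + x * n + y = M + (x * n + y).+1 by rewrite /M; lia.
by rewrite WU ?Ua // /M; lia.
Qed.

End Preparation.

(** * The whole program, its cost and its correctness *)

Definition alpha_code cmp : code :=
  seqc prepare_code
  (seqc (search_code cmp) (straight [:: Const 14 0; Add 0 13 14])).

(** A loop multiplies the cost by [n] and raises the constant by 4: three own steps per turn, and an
    initial step bounded by [n]. *)
Lemma loop_cost n T C k : 0 < n -> T <= C * n ^ k ->
  1 + n * (T + 3) <= (C + 4) * n ^ k.+1.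
Proof.
move=> n0 TC; rewrite expnS.
have nk : 0 < n ^ k by rewrite expn_gt0 n0.
apply: leq_trans (_ : n + n * (C * n ^ k + 3) <= _).
  by rewrite leq_add // leq_mul2l leq_add2r TC orbT.
by rewrite -{1}(muln1 n) -mulnDr mulnCA leq_mul2l; apply/orP; right; nia.
Qed.

Lemma alpha_cost n : 0 < n ->
  80 + n * 3 + n * n * 7
  + (1 + n * (1 + n * (1 + n * (1 + n * (6 + n * (34 + 12 * n) + 3) + 3) + 3) + 3)
     + 2) <= 160 * n ^ 6 + 160.
Proof.
move=> n0.
(* Here [52 = 6 + 34 + 12]; the four loops then give [68 * n ^ 6]. *)
have c2 : 6 + n * (34 + 12 * n) <= 52 * n ^ 2 by rewrite -mulnn; nia.
have := loop_cost n0 (loop_cost n0 (loop_cost n0 (loop_cost n0 c2))).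
have n2 : n <= n ^ 2 by rewrite -mulnn leq_pmull.
have : n ^ 2 <= n ^ 6 by rewrite leq_pexp2l.
rewrite mulnn; lia.
Qed.

Section Correctness.
Variables (n : nat) (G : sgraph 'I_n).
Hypothesis n0 : 0 < n.

Let adj : pred nat :=
  fun r => [exists i : 'I_n, exists j : 'I_n, (r == (i * n + j).+1) && G i j].

Lemma adjE (x y : 'I_n) : adj (x * n + y).+1 = G x y.
Proof.
apply/existsP/idP => [[i /existsP[j /andP[]]]|Gxy]; last first.
  by exists x; apply/existsP; exists y; rewrite eqxx.
rewrite eqSS => /eqP eq_ij.
have xi : x = i.
  apply/val_inj; move/(congr1 (divn^~ n)): eq_ij.
  by rewrite /= !divnMDl // (divn_small (ltn_ord y)) (divn_small (ltn_ord j))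
             !addn0.
by move: eq_ij; rewrite xi => /addnI/val_inj ->.
Qed.

Lemma adj1 : adj 1 = false.
Proof.
have := adjE (Ordinal n0) (Ordinal n0).
by rewrite edge_irr /= mul0n.
Qed.

(** [H] is [G] or, when [cmp] is set, its complement; negated bits are wrong on the diagonal, hence
    [x != y]. No greedy set exceeds [alpha H] and some tuple attains it. *)
Lemma wp_alpha cmp (H : sgraph 'I_n) : free_3K2 H ->
  (forall x y, x != y -> H x y = G x y (+) cmp) ->
  wp (alpha_code cmp) (160 * n ^ 6 + 160) (fun Y => Y 0 = alpha H) (input G).
Proof.
move=> free HG.
apply: (wp_weaken _ (alpha_cost n0) (fun _ => id)).
have inputE r : 0 < r -> input G r = adj r by rewrite /input => /gtn_eqF ->.
apply: wp_seqc; apply: (wp_weaken (wp_prepare n0 adj1 _ inputE)) => //.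
move=> X [eX X13].
have b16 : 16 <= 16 + n * n by rewrite leq_addr.
have bs : 16 + n * n + n * n <= 31 + 2 * (n * n) by lia.
apply: wp_seqc; apply: (wp_weaken (wp_search cmp n0 b16 bs eX)) => // Y [eY Y13].
apply: wp_straight => //; do !rewrite afterE ?set_regE /= ?addn0.
rewrite Y13 X13 max0n.
set e := fun x y => adj (x * n + y).+1 (+) cmp.
have eH (x y : 'I_n) : x != y -> e x y = H x y by move=> xy; rewrite /e adjE HG.
have sel_le v w v' w' :
    size (selected (fun x y => adj (x * n + y).+1) cmp v w v' w' n) <= alpha H.
  exact: size_greedy_le_alpha.
apply/eqP; rewrite eqn_leq; apply/andP; split.
  do 4![apply/bigmax_leqP => ? _]; exact: sel_le.
have [v [w [v' [w' <-]]]] := alpha_greedy eH free n0.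
apply: (bigmax_sup v) => //; apply: (bigmax_sup w) => //.
by apply: (bigmax_sup v') => //; apply: (bigmax_sup w').
Qed.

End Correctness.

Lemma alpha_computable cmp n (G H : sgraph 'I_n) : 0 < n -> free_3K2 H ->
  (forall x y, x != y -> H x y = G x y (+) cmp) ->
  exists2 t, t <= 160 * n ^ 6 + 160 &
    let m := iter t (step (alpha_code cmp 0)) (0, input G) in
    halted (alpha_code cmp 0) m /\ m.2 0 = alpha H.
Proof.
move=> n0 free HG; have [t tT [Y run Y0]] := wp_alpha n0 free HG.
(* With nothing around it the fragment is the whole program, so reaching its end means halting. *)
exists t => //; have := run [::] [::]; rewrite cats0 => /= ->.
by rewrite /halted add0n leqnn.
Qed.

Theorem theorem6p3 :
  poly_time_computable_on (fun n (G : sgraph 'I_n) => one_HNG G)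
                          (fun n (G : sgraph 'I_n) => omega G) /\
  poly_time_computable_on (fun n (G : sgraph 'I_n) => one_HNG G)
                          (fun n (G : sgraph 'I_n) => alpha G).
Proof.
split.
  exists (alpha_code true 0), 160, 6 => n G n0 hG; rewrite omega_complement.
  apply: alpha_computable => // [|x y xy].
    exact/one_HNG_free_3K2/one_HNG_complement.
  by rewrite addbT /= /co_edge xy.
exists (alpha_code false 0), 160, 6 => n G n0 hG.
apply: alpha_computable => // [|x y _]; first exact: one_HNG_free_3K2.
by rewrite addbF.
Qed.
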